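(* For moderate dimensional $\mathsf{Max\text{-}IP}$, $\mathsf{Min\text{-}IP}$ and $\mathsf{Exact\text{-}IP}$, either all of them are in truly subquadratic time, or none of them are.
   Context: For sets $A,B\subseteq\{0,1\}^d$ with $|A|=|B|=n$: $\mathsf{Max\text{-}IP}_{n,d}$ / $\mathsf{Min\text{-}IP}_{n,d}$ ask to compute $\max$ / $\min$ of $\langle a,b\rangle$ over $(a,b)\in A\times B$; $\mathsf{Exact\text{-}IP}_{n,d}$ asks, given also an integer $0\le m\le d$, whether some $(a,b)\in A\times B$ has $\langle a,b\rangle=m$. A problem $\Pi$ on Boolean vectors is, in moderate dimension, in truly subquadratic time if there are constants $\varepsilon,\delta>0$ such that $\Pi$ is solvable in $n^{2-\varepsilon}$ time on $n$ vectors with $n^{\delta}$ dimensions. *)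

(* Defs.v *)
From Stdlib Require Import Reals.
From mathcomp Require Import all_boot.

Delimit Scope R_scope with coqR.

Set Implicit Arguments.
Unset Strict Implicit.
Unset Printing Implicit Defensive.

(* The model of computation is the word RAM: memory cells hold [w]-bit words,
   and every elementary operation costs one time unit.  Memory is presented as
   registers [r] plus arrays [a] addressed by words; since a program names
   finitely many registers and arrays, this is a single word-addressed memory
   up to interleaving.  Control flow is structured. *)

Inductive binop : Type :=
  OAdd | OSub | OMul | ODiv | OMod | OAnd | OOr | OXor | OShl | OShr | OEq | OLt.

Inductive cmd : Type :=
| Skip
| Const (x k : nat)                     (* r[x] := k *)
| Op (x : nat) (o : binop) (y z : nat)  (* r[x] := r[y] o r[z] *)
| Read (x a y : nat)                    (* r[x] := a[r[y]] *)
| Write (a y x : nat)                   (* a[r[y]] := r[x] *)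
| Seq (c1 c2 : cmd)
| If (x : nat) (c1 c2 : cmd)            (* tests r[x] <> 0 *)
| While (x : nat) (c : cmd).            (* tests r[x] <> 0 *)

Record state : Type := State { reg : nat -> nat; arr : nat -> nat -> nat }.

Definition word_state (w : nat) (s : state) : Prop :=
  (forall x, reg s x < 2 ^ w) /\ (forall a i, arr s a i < 2 ^ w).

Definition upd (T : Type) (f : nat -> T) (x : nat) (v : T) : nat -> T :=
  fun y => if y == x then v else f y.

Definition set_reg (s : state) (x v : nat) : state :=
  State (upd (reg s) x v) (arr s).

Definition set_arr (s : state) (a i v : nat) : state :=
  State (reg s) (upd (arr s) a (upd (arr s a) i v)).

(* On words [u v < 2 ^ w]; all results are reduced modulo [2 ^ w]. *)
Definition eval_op (w : nat) (o : binop) (u v : nat) : nat :=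
  match o with
  | OAdd => u + v
  | OSub => 2 ^ w + u - v
  | OMul => u * v
  | ODiv => u %/ v
  | OMod => u %% v
  | OAnd => Nat.land u v
  | OOr => Nat.lor u v
  | OXor => Nat.lxor u v
  | OShl => u * 2 ^ v
  | OShr => u %/ 2 ^ v
  | OEq => u == v
  | OLt => u < v
  end %% 2 ^ w.

(* [exec w c s t s']: with word size [w], the program [c] started in [s] halts
   in [s'] after exactly [t] time units. *)
Inductive exec (w : nat) : cmd -> state -> nat -> state -> Prop :=
| exec_Skip s : exec w Skip s 1 s
| exec_Const s x k : exec w (Const x k) s 1 (set_reg s x (k %% 2 ^ w))
| exec_Op s x o y z :
    exec w (Op x o y z) s 1 (set_reg s x (eval_op w o (reg s y) (reg s z)))
| exec_Read s x a y : exec w (Read x a y) s 1 (set_reg s x (arr s a (reg s y)))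
| exec_Write s a y x :
    exec w (Write a y x) s 1 (set_arr s a (reg s y) (reg s x))
| exec_Seq s1 s2 s3 c1 c2 t1 t2 :
    exec w c1 s1 t1 s2 -> exec w c2 s2 t2 s3 ->
    exec w (Seq c1 c2) s1 (t1 + t2) s3
| exec_If_true s s' x c1 c2 t :
    reg s x != 0 -> exec w c1 s t s' -> exec w (If x c1 c2) s t.+1 s'
| exec_If_false s s' x c1 c2 t :
    reg s x = 0 -> exec w c2 s t s' -> exec w (If x c1 c2) s t.+1 s'
| exec_While_false s x c : reg s x = 0 -> exec w (While x c) s 1 s
| exec_While_true s1 s2 s3 x c t1 t2 :
    reg s1 x != 0 -> exec w c s1 t1 s2 -> exec w (While x c) s2 t2 s3 ->
    exec w (While x c) s1 (t1 + t2).+1 s3.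

Definition vec (d : nat) : finType := d.-tuple bool.

Definition ip (d : nat) (a b : vec d) : nat :=
  \sum_(i < d) tnth a i * tnth b i.

(* A problem on two sets of Boolean vectors, together with a list of integers
   given as additional input; [side_input d] says which lists are legal. *)
Record problem : Type := Problem {
  side_input : nat -> pred (seq nat);
  correct : forall d : nat, {set vec d} -> {set vec d} -> seq nat -> nat -> Prop
}.

Definition Max_IP : problem :=
  Problem (fun _ e => e == [::])
    (fun d A B _ v =>
      (exists a b, [/\ a \in A, b \in B & ip a b = v]) /\
      (forall a b, a \in A -> b \in B -> ip a b <= v)).

Definition Min_IP : problem :=
  Problem (fun _ e => e == [::])
    (fun d A B _ v =>
      (exists a b, [/\ a \in A, b \in B & ip a b = v]) /\
      (forall a b, a \in A -> b \in B -> v <= ip a b)).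

(* The answer is 1 for yes and 0 for no. *)
Definition Exact_IP : problem :=
  Problem (fun d e => if e is [:: m] then m <= d else false)
    (fun d A B e v =>
      v = [exists a in A, exists b in B, ip a b == head 0 e] :> nat).

(* The first [n * d] cells of [f] list the [n] elements of [A], in any order. *)
Definition lists (n d : nat) (A : {set vec d}) (f : nat -> nat) : Prop :=
  exists l : n.-tuple (vec d),
    perm_eq l (enum A) /\
    forall (i : 'I_n) (j : 'I_d), f (i * d + j) = tnth (tnth l i) j :> nat.

(* Registers and cells that do not hold the input are unconstrained: programs
   may not rely on the contents of uninitialised memory. *)
Definition encodes (n d : nat) (A B : {set vec d}) (e : seq nat) (s : state) :
    Prop :=
  [/\ reg s 0 = n, reg s 1 = d,
      forall i, i < size e -> reg s i.+2 = nth 0 e i,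
      lists n A (arr s 0) & lists n B (arr s 1)].

(* [P] is solvable in time O(T(n)) on n vectors with (at most) D(n) dimensions,
   on a word RAM with words of O(log n) bits: the program may assume that a word
   has at least [k * log2 (n + d + 1)] bits, for a constant [k] of its own
   choice.  The answer is left in register 0. *)
Definition solvable (P : problem) (D T : nat -> R) : Prop :=
  exists (c : cmd) (k : nat) (C : R),
  forall (n d : nat) (A B : {set vec d}) (e : seq nat) (w : nat) (s : state),
    0 < n -> (INR d <= D n)%coqR -> #|A| = n -> #|B| = n -> side_input P d e ->
    (n + d).+1 ^ k <= 2 ^ w -> word_state w s -> encodes n A B e s ->
    exists (t : nat) (s' : state),
      [/\ exec w c s t s', correct P A B e (reg s' 0) & (INR t <= C * T n)%coqR].

Definition truly_subquadratic (P : problem) : Prop :=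
  exists eps delta : R,
    [/\ (0 < eps)%coqR, (0 < delta)%coqR &
        solvable P (fun n => Rpower (INR n) delta)
                   (fun n => Rpower (INR n) (2 - eps))].

(* Main.v *)
(** Each of the three problems reduces to the next in the cycle
    Max-IP, Exact-IP, Min-IP, Max-IP, on the same number of vectors.
    Max-IP: ask Exact-IP for m = d, d - 1, ... until the answer is yes.
    Min-IP: replacing each coordinate x of a by (1 - x, x) and each coordinate
    y of b by (1, 1 - y) turns <a, b> into d - <a, b>, in dimension 2d.
    Exact-IP: tensoring a and b with themselves gives <a, b>^2, and 2m copies
    of the previous gadget give 2m(d - <a, b>); the sum is
    (<a, b> - m)^2 + 2md - m^2, whose minimum over A x B is 2md - m^2 exactly
    if some pair has <a, b> = m.  Its dimension d^2 + 4md is at most 5d^2.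
    Dividing delta by 5 leaves room for the larger dimension, except when
    d <= 1, where the answer is computed directly.  The oracle only touches
    registers and arrays below a bound read off from its code, so the reductions
    keep their data above that bound. *)

From Stdlib Require Import ZArith Reals Lra Classical.
From mathcomp Require Import all_boot zify.
Require Import Defs.

Set Implicit Arguments.
Unset Strict Implicit.
Unset Printing Implicit Defensive.

(** * What an execution can change, and the word-size invariant *)

Fixpoint cmd_bound (c : cmd) : nat :=
  match c with
  | Skip => 0
  | Const x _ => x.+1
  | Op x _ y z => maxn x.+1 (maxn y.+1 z.+1)
  | Read x a y | Write a y x => maxn x.+1 (maxn a.+1 y.+1)
  | Seq c1 c2 => maxn (cmd_bound c1) (cmd_bound c2)
  | If x c1 c2 => maxn x.+1 (maxn (cmd_bound c1) (cmd_bound c2))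
  | While x c => maxn x.+1 (cmd_bound c)
  end.

Lemma upd_same (T : Type) (f : nat -> T) x v : upd f x v x = v.
Proof. by rewrite /upd eqxx. Qed.

Lemma upd_other (T : Type) (f : nat -> T) x y v : y != x -> upd f x v y = f y.
Proof. by rewrite /upd => /negbTE ->. Qed.

(** An instruction changes only a register or an array that it names, whatever address it computes.
    So data stored from the bound on survive a call to an oracle whose code is arbitrary. *)
Lemma exec_frame w c s t s' N :
  exec w c s t s' -> cmd_bound c <= N ->
  (forall x, N <= x -> reg s' x = reg s x) /\
  (forall a, N <= a -> arr s' a = arr s a).
Proof.
elim=> {c s t s'} //=.
- by move=> s x k lN; split=> // y ly; rewrite upd_other //; lia.
- by move=> s x o y z lN; split=> // u lu; rewrite upd_other //; lia.
- by move=> s x a y lN; split=> // u lu; rewrite upd_other //; lia.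
- by move=> s a y x lN; split=> // u lu; rewrite upd_other //; lia.
- move=> s1 s2 s3 c1 c2 t1 t2 _ IH1 _ IH2 lN.
  have [|r1 a1] := IH1; first by lia.
  have [|r2 a2] := IH2; first by lia.
  by split=> u lu; [rewrite r2 // r1 | rewrite a2 // a1].
- by move=> s s' x c1 c2 t _ _ IH lN; apply: IH; lia.
- by move=> s s' x c1 c2 t _ _ IH lN; apply: IH; lia.
- move=> s1 s2 s3 x c t1 t2 _ _ IH1 _ IH2 lN.
  have [|r1 a1] := IH1; first by lia.
  have [|r2 a2] := IH2; first by lia.
  by split=> u lu; [rewrite r2 // r1 | rewrite a2 // a1].
Qed.

Lemma ltn_mod_word m w : m %% 2 ^ w < 2 ^ w.
Proof. by rewrite ltn_mod expn_gt0. Qed.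

Lemma word_set_reg w s x v :
  word_state w s -> v < 2 ^ w -> word_state w (set_reg s x v).
Proof. by move=> [wr wa] lv; split=> //= y; rewrite /upd; case: eqP. Qed.

Lemma exec_word w c s t s' :
  exec w c s t s' -> word_state w s -> word_state w s'.
Proof.
elim=> {c s t s'} //=.
- by move=> s x k ws; apply: word_set_reg; rewrite ?ltn_mod_word.
- by move=> s x o y z ws; apply: word_set_reg; rewrite ?ltn_mod_word.
- by move=> s x a y ws; apply: word_set_reg => //; apply: ws.2.
- move=> s a y x [wr wa]; split=> //= u i.
  by rewrite /upd; case: eqP => // _; case: eqP.
- by move=> s1 s2 s3 c1 c2 t1 t2 _ IH1 _ IH2 /IH1/IH2.
- by move=> s1 s2 s3 x c t1 t2 _ _ IH1 _ IH2 /IH1/IH2.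
Qed.

(** * Compiling expressions into loop-free programs *)

Inductive exp : Type :=
| Var (x : nat)
| Cst (k : nat)
| Bin (o : binop) (e1 e2 : exp)
| Get (a : nat) (e : exp)
| Cond (e1 e2 e3 : exp).

Fixpoint eval (w : nat) (s : state) (e : exp) : nat :=
  match e with
  | Var x => reg s x
  | Cst k => k %% 2 ^ w
  | Bin o e1 e2 => eval_op w o (eval w s e1) (eval w s e2)
  | Get a e1 => arr s a (eval w s e1)
  | Cond e1 e2 e3 => if eval w s e1 != 0 then eval w s e2 else eval w s e3
  end.

(** Array names are left free: evaluation writes to no array, so only registers can clash with the
    scratch space. *)
Fixpoint below (r : nat) (e : exp) : bool :=
  match e with
  | Var x => x < r
  | Cst _ => true
  | Bin _ e1 e2 => below r e1 && below r e2
  | Get _ e1 => below r e1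
  | Cond e1 e2 e3 => [&& below r e1, below r e2 & below r e3]
  end.

(* The value of [e] is left in register [r]; registers above [r] are scratch. *)
Fixpoint comp (r : nat) (e : exp) : cmd :=
  match e with
  | Var x => Op r OOr x x
  | Cst k => Const r k
  | Bin o e1 e2 => Seq (comp r e1) (Seq (comp r.+1 e2) (Op r o r r.+1))
  | Get a e1 => Seq (comp r e1) (Read r a r)
  | Cond e1 e2 e3 => Seq (comp r e1) (If r (comp r e2) (comp r e3))
  end.

(** A [Cond] is charged for both branches, so that the bound depends on the expression alone and not
    on the state. *)
Fixpoint cost (e : exp) : nat :=
  match e with
  | Var _ | Cst _ => 1
  | Bin _ e1 e2 => cost e1 + cost e2 + 1
  | Get _ e1 => cost e1 + 1
  | Cond e1 e2 e3 => cost e1 + cost e2 + cost e3 + 1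
  end.

Definition agree (r : nat) (s s' : state) : Prop :=
  (forall x, x < r -> reg s x = reg s' x) /\
  (forall a i, arr s a i = arr s' a i).

Lemma agree_refl r s : agree r s s.
Proof. by []. Qed.

Lemma agree_trans r s1 s2 s3 : agree r s1 s2 -> agree r s2 s3 -> agree r s1 s3.
Proof.
move=> [r1 a1] [r2 a2].
by split=> [y ly|b k]; [rewrite r1 ?r2 | rewrite a1 a2].
Qed.

Lemma agree_set_reg r s1 s2 x v :
  agree r s1 s2 -> agree r (set_reg s1 x v) (set_reg s2 x v).
Proof.
move=> [r1 a1]; split=> //= y ly; rewrite /upd; case: eqP => // _; exact: r1.
Qed.

Lemma below_leq r r' e : r <= r' -> below r e -> below r' e.
Proof.
move=> lr; elim: e => [x|k|o e1 IH1 e2 IH2|a e1 IH1|e1 IH1 e2 IH2 e3 IH3] //=.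
- by move=> /leq_trans; apply.
- by move=> /andP[/IH1 -> /IH2 ->].
- by move=> /and3P[/IH1 -> /IH2 -> /IH3 ->].
Qed.

Lemma eval_agree w r s s' e :
  agree r s s' -> below r e -> eval w s e = eval w s' e.
Proof.
move=> [ar aa]; elim: e => [x|k|o e1 IH1 e2 IH2|a e1 IH1|e1 IH1 e2 IH2 e3 IH3] //=.
- exact: ar.
- by move=> /andP[/IH1 -> /IH2 ->].
- by move=> /IH1 ->.
- by move=> /and3P[/IH1 -> /IH2 -> /IH3 ->].
Qed.

Lemma word_gt1 w : 0 < w -> 1 < 2 ^ w.
Proof. by move=> w0; rewrite -{1}(expn0 2) ltn_exp2l. Qed.

Lemma eval_lt w u v : 0 < w -> eval_op w OLt u v = (u < v).
Proof.
by move=> /word_gt1 w1; rewrite /eval_op modn_small //; case: (u < v); lia.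
Qed.

Lemma eval_eq w u v : 0 < w -> eval_op w OEq u v = (u == v).
Proof.
by move=> /word_gt1 w1; rewrite /eval_op modn_small //; case: (u == v); lia.
Qed.

Lemma eval_add w u v : u + v < 2 ^ w -> eval_op w OAdd u v = u + v.
Proof. exact: modn_small. Qed.

Lemma eval_mul w u v : u * v < 2 ^ w -> eval_op w OMul u v = u * v.
Proof. exact: modn_small. Qed.

Lemma eval_sub w u v : v <= u < 2 ^ w -> eval_op w OSub u v = u - v.
Proof. by move=> luv; rewrite /eval_op -addnBA ?modnDl ?modn_small; lia. Qed.

Lemma eval_div w u v : u < 2 ^ w -> eval_op w ODiv u v = u %/ v.
Proof. by move=> lu; rewrite /eval_op modn_small // (leq_ltn_trans (leq_div _ _)). Qed.

Lemma eval_mod w u v : u < 2 ^ w -> eval_op w OMod u v = u %% v.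
Proof. by move=> lu; rewrite /eval_op modn_small // (leq_ltn_trans (leq_mod _ _)). Qed.

(** The instruction set has no register move; a word is copied by taking its bitwise or with
    itself. *)
Lemma eval_or_diag w u : u < 2 ^ w -> eval_op w OOr u u = u.
Proof. by move=> lu; rewrite /eval_op PeanoNat.Nat.lor_diag modn_small. Qed.

(** The second operand is compiled from [r.+1] on, so the first value survives in [r]; as the state
    still agrees with the initial one below [r], the second operand keeps its value too. *)
Lemma exec_comp w r e s :
  word_state w s -> below r e ->
  exists t s', [/\ exec w (comp r e) s t s', t <= cost e, agree r s' s &
                   reg s' r = eval w s e].
Proof.
elim: e r s => [x|k|o e1 IH1 e2 IH2|a e1 IH1|e1 IH1 e2 IH2 e3 IH3] r s ws /=.
- move=> lx; exists 1, (set_reg s r (eval_op w OOr (reg s x) (reg s x))).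
  split=> //; first exact: exec_Op.
    by split=> //= y ly; rewrite upd_other //; lia.
  by rewrite [LHS]upd_same eval_or_diag //; apply: ws.1.
- move=> _; exists 1, (set_reg s r (k %% 2 ^ w)).
  split=> //; first exact: exec_Const.
    by split=> //= y ly; rewrite upd_other //; lia.
  by rewrite /= upd_same.
- move=> /andP[b1 b2].
  have [t1 [s1 [x1 l1 [r1 a1] v1]]] := IH1 r s ws b1.
  have ws1 := exec_word x1 ws.
  have [t2 [s2 [x2 l2 [r2 a2] v2]]] := IH2 r.+1 s1 ws1 (below_leq (leqnSn r) b2).
  exists (t1 + (t2 + 1)), (set_reg s2 r (eval_op w o (reg s2 r) (reg s2 r.+1))).
  split; first by apply: exec_Seq x1 (exec_Seq x2 _); apply: exec_Op.
  + by lia.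
  + split=> [y ly|b i] /=; last by rewrite a2 a1.
    by rewrite upd_other; [rewrite r2 ?r1 //; lia | lia].
  + by rewrite /= upd_same r2 // v1 v2 (eval_agree w (conj r1 a1) b2).
- move=> b1; have [t1 [s1 [x1 l1 [r1 a1] v1]]] := IH1 r s ws b1.
  exists (t1 + 1), (set_reg s1 r (arr s1 a (reg s1 r))).
  split; first by apply: exec_Seq x1 _; apply: exec_Read.
  + by lia.
  + split=> [y ly|b i] //=.
    by rewrite upd_other; [rewrite r1 | lia].
  + by rewrite /= upd_same v1 a1.
- move=> /and3P[b1 b2 b3].
  have [t1 [s1 [x1 l1 ag1 v1]]] := IH1 r s ws b1.
  have ws1 := exec_word x1 ws.
  rewrite -v1 -(eval_agree w ag1 b2) -(eval_agree w ag1 b3).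
  have [t2 [s2 [x2 l2 [r2 a2] v2]]] := IH2 r s1 ws1 b2.
  have [t3 [s3 [x3 l3 [r3 a3] v3]]] := IH3 r s1 ws1 b3.
  case: ag1 => r1 a1; case: ifPn => [nz|/negPn/eqP z].
  + exists (t1 + t2.+1), s2; split=> //.
    * by apply: exec_Seq x1 _; apply: exec_If_true.
    * by lia.
    * by split=> [y ly|b i]; rewrite ?r2 ?r1 ?a2 ?a1.
  + exists (t1 + t3.+1), s3; split=> //.
    * by apply: exec_Seq x1 _; apply: exec_If_false.
    * by lia.
    * by split=> [y ly|b i]; rewrite ?r3 ?r1 ?a3 ?a1.
Qed.

(** * Rules for total correctness within a time bound *)

Definition asgn (r x : nat) (e : exp) : cmd := Seq (comp r e) (Op x OOr r r).

Definition runs (w : nat) (c : cmd) (s : state) (T : nat) (Q : state -> Prop) :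
    Prop :=
  exists t s', [/\ exec w c s t s', t <= T, word_state w s' & Q s'].

Lemma runs_seq w c1 c2 s T1 T2 T (Q1 Q2 : state -> Prop) :
  runs w c1 s T1 Q1 ->
  (forall s1, word_state w s1 -> Q1 s1 -> runs w c2 s1 T2 Q2) ->
  T1 + T2 <= T ->
  runs w (Seq c1 c2) s T Q2.
Proof.
move=> [t1 [s1 [x1 l1 ws1 q1]]] /(_ _ ws1 q1)[t2 [s2 [x2 l2 ws2 q2]]] lT.
by exists (t1 + t2), s2; split=> //; [apply: exec_Seq x1 x2 | lia].
Qed.

(** The value is computed at [r] and only then copied to [x]: compiling at [x] itself could
    overwrite live registers above [x]. *)
Lemma runs_asgn w r x e s (Q : state -> Prop) :
  word_state w s -> below r e -> x < r ->
  (forall s', agree r s' (set_reg s x (eval w s e)) -> Q s') ->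
  runs w (asgn r x e) s (cost e + 1) Q.
Proof.
move=> ws be lx q; have [t [s1 [x1 l1 [r1 a1] v1]]] := exec_comp ws be.
have xq : exec w (asgn r x e) s (t + 1)
            (set_reg s1 x (eval_op w OOr (reg s1 r) (reg s1 r))).
  by apply: exec_Seq x1 _; apply: exec_Op.
exists (t + 1), (set_reg s1 x (eval_op w OOr (reg s1 r) (reg s1 r))); split=> //.
- by lia.
- exact: exec_word xq ws.
- rewrite eval_or_diag ?v1 in xq *; last by rewrite -v1; apply: (exec_word x1 ws).1.
  by apply: q; apply: agree_set_reg.
Qed.

Definition ifexp (r : nat) (e : exp) (c1 c2 : cmd) : cmd :=
  Seq (comp r e) (If r c1 c2).

Lemma runs_ifexp w r e c1 c2 s T (Q : state -> Prop) :
  word_state w s -> below r e ->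
  (forall s', word_state w s' -> agree r s' s ->
    runs w (if eval w s e != 0 then c1 else c2) s' T Q) ->
  runs w (ifexp r e c1 c2) s (cost e + T.+1) Q.
Proof.
move=> ws be q; have [t [s1 [x1 l1 ag1 v1]]] := exec_comp ws be.
have ws1 := exec_word x1 ws.
have [t2 [s2 [x2 l2 ws2 q2]]] := q _ ws1 ag1.
exists (t + t2.+1), s2; split=> //; last by lia.
apply: exec_Seq x1 _; move: x2; rewrite -v1; case: ifPn => [nz|/negPn/eqP z] x2.
  exact: exec_If_true.
exact: exec_If_false.
Qed.

(** An array comprehension: cell [i] of [a] receives [e] for all [i] below [len]. Register [r] holds
    in turn the loop test and the value to be stored, so the test is recomputed at the end of each
    round. *)
Definition fill (r a i len : nat) (e : exp) : cmd :=
  let test := comp r (Bin OLt (Var i) (Var len)) in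
  Seq (asgn r i (Cst 0))
    (Seq test
      (While r
        (Seq (comp r e)
          (Seq (Write a i r)
            (Seq (asgn r i (Bin OAdd (Var i) (Cst 1))) test))))).

(** The state after [j] rounds of [fill], up to scratch; it serves as the loop invariant. *)
Definition filled (s : state) (a i : nat) (F : nat -> nat) (j : nat) : state :=
  State (upd (reg s) i j)
        (upd (arr s) a (fun q => if q < j then F q else arr s a q)).

(** Besides [cost e], a round costs 1 for the write, 4 for the increment, 3 for the test and 1 for
    the loop. The extra 6 are 2 for resetting [i], 3 for the first test and 1 for leaving the
    loop. *)
Lemma runs_fill w r a i len e s L F :
  word_state w s -> below r e -> i < r -> len < r -> i != len -> 0 < w ->
  reg s len = L ->
  (forall j s', j < L -> agree r s' (filled s a i F j) -> eval w s' e = F j) ->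
  runs w (fill r a i len e) s ((cost e + 9) * L + 6)
    (fun s' => agree r s' (filled s a i F L)).
Proof.
move=> ws be li ll nil w0 sL eF.
have w1 := word_gt1 w0.
have lL : L < 2 ^ w by rewrite -sL; apply: ws.1.
have bt : below r (Bin OLt (Var i) (Var len)) by rewrite /= li ll.
have test j s1 : agree r s1 (filled s a i F j) ->
    eval w s1 (Bin OLt (Var i) (Var len)) = (j < L).
  move=> ag; rewrite (eval_agree w ag bt) /= upd_same upd_other; last by rewrite eq_sym.
  by rewrite sL eval_lt.
apply: (@runs_seq _ _ _ _ 2 ((cost e + 9) * L + 4) _
         (fun s' => agree r s' (filled s a i F 0))); last by lia.
  apply: runs_asgn => // s' ag; apply: agree_trans ag _.
  rewrite /= mod0n; split=> //= b k; rewrite /upd; by case: eqP => [->|_].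
move=> s1 ws1 ag1.
have [t2 [s2 [x2 l2 ag2 v2]]] := exec_comp ws1 bt.
have {}ag2 := agree_trans ag2 ag1; rewrite (test _ _ ag1) in v2.
have {ws1} ws2 := exec_word x2 ws1.
(* Induction on the number [m] of rounds left. *)
suff loop m : forall j s3, j + m = L -> word_state w s3 ->
    agree r s3 (filled s a i F j) -> reg s3 r = (j < L) ->
    runs w (While r (Seq (comp r e)
          (Seq (Write a i r)
            (Seq (asgn r i (Bin OAdd (Var i) (Cst 1)))
              (comp r (Bin OLt (Var i) (Var len))))))) s3 ((cost e + 9) * m + 1)
      (fun s' => agree r s' (filled s a i F L)).
  have [t3 [s3 [x3 l3 ws3 q3]]] := loop L 0 s2 (add0n _) ws2 ag2 v2.
  exists (t2 + t3), s3; split=> //; first exact: exec_Seq x2 x3.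
  by move: l2 => /=; lia.
elim: m => [|m IH] j s3 jm ws3 ag3 v3.
  exists 1, s3; split=> //; first by apply: exec_While_false; rewrite v3; lia.
    by lia.
  by rewrite -jm addn0.
have [t4 [s4 [x4 l4 ag4 v4]]] := exec_comp ws3 be.
have ws4 := exec_word x4 ws3.
rewrite (eF j) in v4 => //; last by lia.
have {}ag4 := agree_trans ag4 ag3.
pose s5 := set_arr s4 a (reg s4 i) (reg s4 r).
have x5 : exec w (Write a i r) s4 1 s5 by apply: exec_Write.
have ws5 := exec_word x5 ws4.
have r4i : reg s4 i = j by rewrite ag4.1 //= upd_same.
have [t6 [s6 [x6 l6 ws6 q6]]] : runs w (asgn r i (Bin OAdd (Var i) (Cst 1))) s5 4
    (fun s' => agree r s' (filled s a i F j.+1)).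
  apply: runs_asgn => //=; first by rewrite li.
  move=> s' ag; apply: agree_trans ag _; rewrite r4i (modn_small w1) eval_add; last lia.
  split=> [y ly|b k] /=.
    by rewrite /upd; case: eqP => [_|/eqP ne]; [lia | rewrite ag4.1 //= upd_other].
  rewrite /upd; case: (eqVneq b a) => [_|ne].
    rewrite r4i; case: (eqVneq k j) => [->|ne]; first by rewrite v4 leqnn.
    by rewrite ag4.2 /= upd_same; have -> : (k < j.+1) = (k < j) by lia.
  by rewrite ag4.2 /= upd_other.
have [t7 [s7 [x7 l7 ag7 v7]]] := exec_comp ws6 bt.
have {}ag7 := agree_trans ag7 q6; rewrite (test _ _ q6) in v7.
have ws7 := exec_word x7 ws6.
have [|t8 [s8 [x8 l8 ws8 q8]]] := IH j.+1 s7 _ ws7 ag7 v7; first by lia.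
exists (t4 + (1 + (t6 + t7)) + t8).+1, s8; split=> //.
  apply: exec_While_true x8; first by rewrite v3; lia.
  by apply: exec_Seq x4 (exec_Seq x5 (exec_Seq x6 x7)).
by move: l7 => /=; nia.
Qed.

Lemma runs_le w c s T T' (Q : state -> Prop) :
  T <= T' -> runs w c s T Q -> runs w c s T' Q.
Proof. by move=> lT [t [s' [x l ws q]]]; exists t, s'; split=> //; lia. Qed.

Lemma runs_sub w c s T (Q Q' : state -> Prop) :
  (forall s', word_state w s' -> Q s' -> Q' s') ->
  runs w c s T Q -> runs w c s T Q'.
Proof. by move=> qq [t [s' [x l ws q]]]; exists t, s'; split=> //; apply: qq. Qed.

Lemma filled_agree r s1 s2 a i F j :
  agree r s1 s2 -> agree r (filled s1 a i F j) (filled s2 a i F j).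
Proof.
move=> [r1 a1]; split=> [y ly|b k] /=; rewrite /upd.
  by case: eqP => // _; exact: r1.
by case: (eqVneq b a) => [_|_]; [case: (k < j) | ].
Qed.

(** Symbolic execution: [S] is an explicit term that describes the current state up to scratch, and
    the continuation is verified from an update of that term. *)
Lemma runs_asgn_seq w r x e v c s S T (Q : state -> Prop) :
  word_state w s -> agree r s S -> below r e -> x < r -> eval w S e = v ->
  (forall s', word_state w s' -> agree r s' (set_reg S x v) -> runs w c s' T Q) ->
  runs w (Seq (asgn r x e) c) s (cost e + 1 + T) Q.
Proof.
move=> ws ag be lx ev rc.
apply: (@runs_seq _ _ _ _ _ _ _ (fun s' => agree r s' (set_reg S x v))) (leqnn _) => //.
apply: runs_asgn => // s' ag'; apply: agree_trans ag' _.
by rewrite (eval_agree w ag be) ev; apply: agree_set_reg.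
Qed.

Lemma runs_fill_seq w r a i len e c s S L F T (Q : state -> Prop) :
  word_state w s -> agree r s S -> below r e -> i < r -> len < r -> i != len ->
  0 < w -> reg S len = L ->
  (forall j, j < L -> eval w (filled S a i F j) e = F j) ->
  (forall s', word_state w s' -> agree r s' (filled S a i F L) -> runs w c s' T Q) ->
  runs w (Seq (fill r a i len e) c) s ((cost e + 9) * L + 6 + T) Q.
Proof.
move=> ws ag be li ll nil w0 SL eF rc.
apply: (@runs_seq _ _ _ _ _ _ _ (fun s' => agree r s' (filled S a i F L))) (leqnn _) => //.
have := @runs_fill w r a i len e s L F ws be li ll nil w0.
case=> [|j s' lj ag'|t [s' [x l ws' ag']]]; first by rewrite ag.1.
  by rewrite (eval_agree w ag' be) (eval_agree w (filled_agree a i F j ag) be) eF.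
by exists t, s'; split=> //; apply: agree_trans ag' (filled_agree _ _ _ _ ag).
Qed.

Lemma runs_skip w s (Q : state -> Prop) : word_state w s -> Q s -> runs w Skip s 1 Q.
Proof. by exists 1, s; split=> //; apply: exec_Skip. Qed.

(** * Saving the input and loading a query *)

Ltac lookup := rewrite /=; repeat (rewrite upd_same || (rewrite upd_other; [|lia])).

(* Register map for [N] a bound on the oracle program: [N], [N + 1], [N + 2]
   hold [n], [d] and the side input or current guess [m], [N + 3] holds [n * d], [N + 4] the loop
   flag of [search], [N + 5] the index of [fill], [N + 8] the new dimension and
   [N + 9] the length of the new input; [N + 10] and above are scratch for
   [comp].  Arrays [N] and [N + 1] hold copies of the input. *)
Definition saved (N n d m : nat) (f g : nat -> nat) (s : state) : Prop :=
  [/\ reg s N = n, reg s (N + 1) = d, reg s (N + 2) = m,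
      forall q, q < n * d -> arr s N q = f q &
      forall q, q < n * d -> arr s (N + 1) q = g q].

Definition save (N : nat) : cmd :=
  let r := N + 10 in
  Seq (asgn r N (Var 0))
    (Seq (asgn r (N + 1) (Var 1))
      (Seq (asgn r (N + 2) (Var 2))
        (Seq (asgn r (N + 3) (Bin OMul (Var N) (Var (N + 1))))
          (Seq (fill r N (N + 5) (N + 3) (Get 0 (Var (N + 5))))
            (Seq (fill r (N + 1) (N + 5) (N + 3) (Get 1 (Var (N + 5))))
              Skip))))).

Lemma runs_save w N n d s :
  word_state w s -> 2 < N -> 0 < w -> n * d < 2 ^ w ->
  reg s 0 = n -> reg s 1 = d ->
  runs w (save N) s (22 * (n * d) + 23)
    (saved N n d (reg s 2) (arr s 0) (arr s 1)).
Proof.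
move=> ws lN w0 lw s0 s1.
(* The bound is first split into one summand per command, the shape that the sequencing rules
   produce. *)
apply: (@runs_le _ _ _ (1 + 1 + (1 + 1 + (1 + 1 + (3 + 1 +
  (11 * (n * d) + 6 + (11 * (n * d) + 6 + 1))))))); first by lia.
apply: (@runs_asgn_seq _ _ _ _ n _ _ _ _ _ ws (agree_refl _ _)) => //=; try lia.
move=> {ws} u1 ws ag.
apply: (@runs_asgn_seq _ _ _ _ d _ _ _ _ _ ws ag) => //=; try lia; first by lookup.
move=> {ws ag} u2 ws ag.
apply: (@runs_asgn_seq _ _ _ _ (reg s 2) _ _ _ _ _ ws ag) => //=; try lia; first by lookup.
move=> {ws ag} u3 ws ag.
apply: (@runs_asgn_seq _ _ _ _ (n * d) _ _ _ _ _ ws ag) => /=; try lia.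
  by lookup; rewrite eval_mul.
move=> {ws ag} u4 ws ag.
apply: (@runs_fill_seq _ _ _ _ _ (Get 0 (Var (N + 5))) _ _ _ (n * d) (arr s 0) _ _ ws ag) => /=; try lia.
- by lookup.
- by move=> j lj; lookup.
move=> {ws ag} u5 ws ag.
apply: (@runs_fill_seq _ _ _ _ _ (Get 1 (Var (N + 5))) _ _ _ (n * d) (arr s 1) _ _ ws ag) => /=; try lia.
- by lookup.
- by move=> j lj; lookup.
move=> {ws ag} u6 ws [ar aa]; apply: runs_skip => //; split.
- by rewrite ar; [lookup | lia].
- by rewrite ar; [lookup | lia].
- by rewrite ar; [lookup | lia].
- by move=> q lq; rewrite aa; lookup; rewrite lq.
- by move=> q lq; rewrite aa; lookup; rewrite lq.
Qed.

Definition load (N : nat) (ed eA eB : exp) : cmd :=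
  let r := N + 10 in
  Seq (asgn r (N + 8) ed)
    (Seq (asgn r (N + 9) (Bin OMul (Var N) (Var (N + 8))))
      (Seq (fill r 0 (N + 5) (N + 9) eA)
        (Seq (fill r 1 (N + 5) (N + 9) eB)
          (Seq (asgn r 0 (Var N))
            (Seq (asgn r 1 (Var (N + 8)))
              (Seq (asgn r 2 (Var (N + 2))) Skip)))))).

Lemma saved_set_reg N n d m f g s x v :
  x != N -> x != N + 1 -> x != N + 2 ->
  saved N n d m f g s -> saved N n d m f g (set_reg s x v).
Proof. by move=> x0 x1 x2 [s0 s1 s2 sA sB]; split=> //; lookup. Qed.

Lemma saved_filled N n d m f g s a i F j :
  a != N -> a != N + 1 -> i != N -> i != N + 1 -> i != N + 2 ->
  saved N n d m f g s -> saved N n d m f g (filled s a i F j).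
Proof. by move=> a0 a1 i0 i1 i2 [s0 s1 s2 sA sB]; split=> //; lookup. Qed.

Lemma saved_agree N n d m f g r s s' :
  N + 10 <= r -> agree r s s' -> saved N n d m f g s' -> saved N n d m f g s.
Proof.
move=> lr [ar aa] [s0 s1 s2 sA sB].
by split; rewrite ?ar ?s0 ?s1 ?s2; try lia; move=> q lq; rewrite aa; auto.
Qed.

Definition loaded (n d m : nat) (F G : nat -> nat) (s : state) : Prop :=
  [/\ reg s 0 = n, reg s 1 = d, reg s 2 = m,
      forall q, q < n * d -> arr s 0 q = F q &
      forall q, q < n * d -> arr s 1 q = G q].

(** The entry expressions may rely only on the saved data, the new dimension in [N + 8] and the flat
    index in [N + 5], since arrays 0 and 1 are overwritten meanwhile. *)
Lemma runs_load w N n d m f g d' F G ed eA eB s :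
  word_state w s -> 2 < N -> 0 < w -> n * d' < 2 ^ w ->
  below (N + 10) ed -> below (N + 10) eA -> below (N + 10) eB ->
  saved N n d m f g s ->
  (forall u, saved N n d m f g u -> eval w u ed = d') ->
  (forall u q, q < n * d' -> saved N n d m f g u -> reg u (N + 8) = d' ->
     reg u (N + 5) = q -> eval w u eA = F q /\ eval w u eB = G q) ->
  runs w (load N ed eA eB) s
    ((cost eA + cost eB + 18) * (n * d') + cost ed + 24)
    (fun s' => saved N n d m f g s' /\ loaded n d' m F G s').
Proof.
move=> ws lN w0 lw bd bA bB sv ved vAB.
apply: (@runs_le _ _ _ (cost ed + 1 + (3 + 1 + ((cost eA + 9) * (n * d') + 6 +
  ((cost eB + 9) * (n * d') + 6 + (1 + 1 + (1 + 1 + (1 + 1 + 1)))))))); first by lia.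
have [s0 s1 s2 sA sB] := sv.
apply: (@runs_asgn_seq _ _ _ _ d' _ _ _ _ _ ws (agree_refl _ _)) => //=; try lia; first exact: ved.
move=> {ws} u1 ws ag.
apply: (@runs_asgn_seq _ _ _ _ (n * d') _ _ _ _ _ ws ag) => //=; try lia.
  by lookup; rewrite s0 eval_mul.
move=> {ws ag} u2 ws ag.
apply: (@runs_fill_seq _ _ _ _ _ eA _ _ _ (n * d') F _ _ ws ag) => //=; try lia.
- by lookup.
- move=> j lj; apply: (proj1 (vAB _ _ lj _ _ _)); try by lookup.
  by apply: saved_filled; try lia; do 2 (apply: saved_set_reg; try lia).
move=> {ws ag} u3 ws ag.
apply: (@runs_fill_seq _ _ _ _ _ eB _ _ _ (n * d') G _ _ ws ag) => //=; try lia.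
- by lookup.
- move=> j lj; apply: (proj2 (vAB _ _ lj _ _ _)); try by lookup.
  by do 2 (apply: saved_filled; try lia); do 2 (apply: saved_set_reg; try lia).
move=> {ws ag} u4 ws ag.
apply: (@runs_asgn_seq _ _ _ _ n _ _ _ _ _ ws ag) => //=; try lia; first by lookup.
move=> {ws ag} u5 ws ag.
apply: (@runs_asgn_seq _ _ _ _ d' _ _ _ _ _ ws ag) => //=; try lia; first by lookup.
move=> {ws ag} u6 ws ag.
apply: (@runs_asgn_seq _ _ _ _ m _ _ _ _ _ ws ag) => //=; try lia; first by lookup.
move=> {ws ag} u7 ws ag; apply: runs_skip => //; split.
  apply: (saved_agree _ ag); first by [].
  by do 3 (apply: saved_set_reg; try lia); do 2 (apply: saved_filled; try lia);
     do 2 (apply: saved_set_reg; try lia).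
case: ag => ar aa; split.
- by rewrite ar; [lookup | lia].
- by rewrite ar; [lookup | lia].
- by rewrite ar; [lookup | lia].
- by move=> q lq; rewrite aa; lookup; rewrite lq.
- by move=> q lq; rewrite aa; lookup; rewrite lq.
Qed.

(** * Oracle calls and listings of sets of vectors *)

Definition oracle (Q : problem) (c : cmd) (w n D T : nat) : Prop :=
  forall d (A B : {set vec d}) e s,
    d <= D -> #|A| = n -> #|B| = n -> side_input Q d e ->
    word_state w s -> encodes n A B e s ->
    runs w c s T (fun s' => correct Q A B e (reg s' 0)).

(** The saved data lie at or above the bound [N] of the oracle's code, so [exec_frame] preserves
    them. *)
Lemma runs_oracle Q c w n D T N d0 m f g d (A B : {set vec d}) e s :
  oracle Q c w n D T -> cmd_bound c <= N -> saved N n d0 m f g s ->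
  d <= D -> #|A| = n -> #|B| = n -> side_input Q d e ->
  word_state w s -> encodes n A B e s ->
  runs w c s T (fun s' => saved N n d0 m f g s' /\ correct Q A B e (reg s' 0)).
Proof.
move=> orc lN [s0 s1 s2 sA sB] ld cA cB se ws en.
have [t [s' [x l ws' q]]] := orc d A B e s ld cA cB se ws en.
have [fr fa] := exec_frame x lN.
exists t, s'; split=> //; split=> //.
split; rewrite ?fr ?fa ?leq_addr //.
Qed.

Lemma lists_index n d (i : 'I_n) (j : 'I_d) : i * d + j < n * d.
Proof. by case: i j => [i li] [j lj] /=; nia. Qed.

Lemma lists_ext n d (A : {set vec d}) f g :
  (forall q, q < n * d -> f q = g q) -> lists n A g -> lists n A f.
Proof.
move=> fg [l [pl lg]]; exists l; split=> // i j.
by rewrite fg ?lg // lists_index.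
Qed.

Lemma lists_bool n d (A : {set vec d}) f q :
  lists n A f -> q < n * d -> f q = (f q != 0).
Proof.
move=> [l [_ lf]] lq.
have d0 : 0 < d by case: (posnP d) lq => // ->; rewrite muln0.
have li : q %/ d < n by rewrite ltn_divLR.
have lj : q %% d < d by rewrite ltn_mod.
have := lf (Ordinal li) (Ordinal lj); rewrite /= -divn_eq => ->.
by case: (tnth _ _).
Qed.

Lemma loaded_encodes n d m F G (A B : {set vec d}) e s :
  loaded n d m F G s -> lists n A F -> lists n B G ->
  e = [::] \/ e = [:: m] -> encodes n A B e s.
Proof.
move=> [s0 s1 s2 sF sG] lA lB he; split=> //.
- by case: he => -> [|i].
- exact: lists_ext lA.
- exact: lists_ext lB.
Qed.

(* The bound [d ^ 5] on the dimension of the queries forces them to keep the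
   dimension when [d <= 1], and allows [5 * d ^ 2] as soon as [d >= 2].  It
   amounts to dividing [delta] by 5. *)
Definition reduces (P Q : problem) : Prop :=
  forall c, exists c' K, forall n d (A B : {set vec d}) e w s T,
    0 < n -> #|A| = n -> #|B| = n -> side_input P d e ->
    (n + d).+1 ^ 8 <= 2 ^ w -> word_state w s -> encodes n A B e s ->
    oracle Q c w n (d ^ 5) T ->
    runs w c' s (d.+1 * T + K * (n * d.+1 ^ 2))
      (fun s' => correct P A B e (reg s' 0)).

(** * The gadget vectors and their inner products *)

(* Coordinates come in blocks of length [d].  Each of the first [P] blocks is
   the vector times one of its own entries; then [Q - P] blocks pair with their
   partners on the other side to contribute [1 - x y], split as
   [(1 - x) * 1 + x * (1 - y)] over two groups of blocks. *)
Definition gadget (side : bool) (d P Q : nat) (x : nat -> bool) (k : nat) : bool :=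
  let j := k %% d in
  let b := k %/ d in
  if b < P then x j && x b
  else if b < Q then side || ~~ x j
  else side (+) x j.

Definition gadget_vec (side : bool) (d P Q d' : nat) (a : vec d) : vec d' :=
  [tuple gadget side d P Q (nth false a) k | k < d'].

Lemma nth_gadget_vec side d P Q d' (a : vec d) k :
  k < d' -> nth false (gadget_vec side P Q d' a) k = gadget side d P Q (nth false a) k.
Proof.
by move=> lk; rewrite -(tnth_nth false _ (Ordinal lk)) tnth_mktuple.
Qed.

Lemma ipE d (a b : vec d) :
  ip a b = \sum_(0 <= j < d) nth false a j * nth false b j.
Proof.
by rewrite /ip big_mkord; apply: eq_bigr => i _; rewrite !(tnth_nth false).
Qed.

Lemma sum_blocks d nb (F : nat -> nat) :
  \sum_(0 <= k < nb * d) F k =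
  \sum_(0 <= b < nb) \sum_(0 <= j < d) F (b * d + j).
Proof.
elim: nb => [|nb IH]; first by rewrite !big_geq.
rewrite big_nat_recr //= -IH (@big_cat_nat _ _ _ (nb * d)) //=; last by rewrite leq_mul2r leqnSn orbT.
congr (_ + _); rewrite -{1}[nb * d]add0n big_addn mulSn addnK.
by apply: eq_bigr => j _; rewrite addnC.
Qed.

(** The flag [p] switches the tensor square on or off. Block [c] of the square contributes
    [x c * y c * ip a b]; a block of the second group contributes [S1] and one of the third [S2],
    with [S1 + S2 = d - ip a b]. *)
Lemma gadget_ip d (p : bool) q (a b : vec d) :
  let P := p * d in
  let d' := (P + 2 * q) * d in
  ip (gadget_vec false P (P + q) d' a) (gadget_vec true P (P + q) d' b) =
  p * ip a b ^ 2 + q * (d - ip a b).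
Proof.
move=> P d'; rewrite ipE /d'.
pose F k := gadget false d P (P + q) (nth false a) k * gadget true d P (P + q) (nth false b) k.
rewrite (@eq_big_nat _ _ _ _ _ _ F); last by move=> k lk; rewrite !nth_gadget_vec.
rewrite sum_blocks.
pose x := nth false a; pose y := nth false b.
have Fbj c j : j < d -> F (c * d + j) =
   if c < P then (x j && x c) * (y j && y c)
   else if c < P + q then ~~ x j : nat else x j * ~~ y j.
  move=> lj; have d0 : 0 < d by lia.
  rewrite /F /gadget divnMDl // (divn_small lj) addn0 modnMDl modn_small //.
  by case: ifP => // _; case: ifP => // _; rewrite muln1.
pose S1 := \sum_(0 <= j < d) ~~ x j.
pose S2 := \sum_(0 <= j < d) x j * ~~ y j.
have S12 : S1 + S2 = d - ip a b.
  (* Coordinatewise this is [(1 - x) + x (1 - y) + x y = 1]. *)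
  suff eqd : S1 + S2 + ip a b = d by lia.
  rewrite ipE /S1 /S2 -!big_split /= -[RHS]subn0 -[RHS]muln1 -sum_nat_const_nat.
  by apply: eq_bigr => j _; rewrite -/x -/y; case: (x j); case: (y j).
rewrite (@big_cat_nat _ _ _ P) //=; last by lia.
rewrite (@big_cat_nat _ _ _ (P + q) P) //=; try lia.
rewrite (@eq_big_nat _ _ _ 0 P _ (fun c => x c * y c * ip a b)); last first.
  move=> c lc; rewrite ipE big_distrr /=; apply: eq_big_nat => j /andP[_ lj].
  rewrite Fbj //; have -> : c < P by lia.
  by rewrite -/x -/y; case: (x j); case: (x c); case: (y j); case: (y c).
rewrite (@eq_big_nat _ _ _ P (P + q) _ (fun c => S1)); last first.
  move=> c lc; apply: eq_big_nat => j /andP[_ lj].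
  by rewrite Fbj //; case: ifP => // ?; [lia | case: ifP => // ?; lia].
rewrite (@eq_big_nat _ _ _ (P + q) _ _ (fun c => S2)); last first.
  move=> c lc; apply: eq_big_nat => j /andP[_ lj].
  by rewrite Fbj //; case: ifP => // ?; [lia | case: ifP => // ?; lia].
rewrite !sum_nat_const_nat -S12 -big_distrl /=.
have -> : (\sum_(0 <= c < P) x c * y c) * ip a b = p * ip a b ^ 2.
  rewrite /P; case: (p); last by rewrite !mul0n big_geq.
  by rewrite !mul1n ipE mulnn.
by nia.
Qed.

(** Injectivity keeps the number of vectors at [n]. With the tensor square, entry [j] of block [j]
    is [x j && x j = x j]; without it, block [q] is [x] or its complement. *)
Lemma gadget_vec_inj side d (p : bool) q :
  p || (0 < q) ->
  injective (@gadget_vec side d (p * d) (p * d + q) ((p * d + 2 * q) * d)).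
Proof.
move=> pq a b /(congr1 (fun v : vec _ => nth false v)) eab.
apply/val_inj/(@eq_from_nth _ false); rewrite !size_tuple // => j lj.
have d0 : 0 < d by lia.
have eqk c : c < p * d + 2 * q ->
    gadget side d (p * d) (p * d + q) (nth false a) (c * d + j) =
    gadget side d (p * d) (p * d + q) (nth false b) (c * d + j).
  move=> lc; have lk : c * d + j < (p * d + 2 * q) * d by nia.
  by have := congr1 (fun h => h (c * d + j)) eab; rewrite !nth_gadget_vec.
case: p pq eqk {eab} => /= [_|q0].
  move=> /(_ j); rewrite /gadget divnMDl // (divn_small lj) addn0 modnMDl modn_small //.
  by rewrite mul1n lj !andbb; apply; lia.
move=> /(_ q); rewrite /gadget divnMDl // (divn_small lj) addn0 modnMDl modn_small //.
by rewrite ltn0 ltnn => /(_ _)/addbI; apply; lia.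
Qed.

(** * Computing the gadget on the word RAM *)

Definition gadget_exp (side : bool) (N src : nat) (eP eQ : exp) : exp :=
  let d := Var (N + 1) in
  let i := Bin ODiv (Var (N + 5)) (Var (N + 8)) in
  let k := Bin OMod (Var (N + 5)) (Var (N + 8)) in
  let j := Bin OMod k d in
  let b := Bin ODiv k d in
  let x t := Get src (Bin OAdd (Bin OMul i d) t) in
  let notx := Cond (x j) (Cst 0) (Cst 1) in
  Cond (Bin OLt b eP) (Cond (x j) (x b) (Cst 0))
    (Cond (Bin OLt b eQ) (if side then Cst 1 else notx)
       (if side then notx else x j)).

(** The flat index splits by [d'] into vector number and coordinate, and the coordinate by [d] into
    block and offset. As [P <= d], a block number below [P] is itself a legal coordinate; the bounds
    by [2 ^ w] keep the arithmetic exact. *)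
Lemma eval_gadget_exp side N src eP eQ w n d d' P Q f u q :
  0 < w -> n * d < 2 ^ w -> n * d' < 2 ^ w -> 0 < d -> P <= d ->
  reg u (N + 1) = d -> reg u (N + 5) = q -> reg u (N + 8) = d' -> q < n * d' ->
  eval w u eP = P -> eval w u eQ = Q ->
  (forall q, q < n * d -> arr u src q = f q) ->
  (forall q, q < n * d -> f q = (f q != 0)) ->
  eval w u (gadget_exp side N src eP eQ) =
  gadget side d P Q (fun t => f (q %/ d' * d + t) != 0) (q %% d').
Proof.
move=> w0 lnd lnd' d0 lP ud uq ud' lq uP uQ uf fb; have w1 := word_gt1 w0.
have d'0 : 0 < d' by case: (posnP d') lq => // ->; rewrite muln0.
have li : q %/ d' < n by rewrite ltn_divLR.
have lk : q %% d' < 2 ^ w.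
  by apply: leq_ltn_trans (leq_mod _ _) _; lia.
set i := q %/ d'; set k := q %% d'.
have lj : k %% d < d by rewrite ltn_mod.
have lij t : t < d -> i * d + t < n * d by rewrite -/i in li; nia.
have xt t : t < d -> arr u src (eval_op w OAdd (i * d) t) = (f (i * d + t) != 0).
  by move=> lt; have lt' := lij t lt; rewrite eval_add ?uf -?fb //; lia.
have ui : eval_op w OMul (eval_op w ODiv q d') d = i * d.
  by rewrite eval_div ?eval_mul //; [rewrite -/i in li; nia | lia].
have uk : eval_op w OMod q d' = k by rewrite eval_mod //; lia.
rewrite /gadget_exp; case: side;
  rewrite /= ud uq ud' uP uQ ui uk eval_mod // eval_div // !eval_lt // (xt _ lj)
    mod0n (modn_small w1) /gadget;
  case lb : (k %/ d < P) => /=; rewrite ?(xt (k %/ d)); try lia;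
  case: (f (i * d + k %% d) != 0) => //=; case: (k %/ d < Q) => //;
  by case: (f _ != 0).
Qed.

(** The order of the vectors is kept; by injectivity the mapped list has no repetition, hence
    enumerates the image. *)
Lemma lists_gadget side n d d' (p : bool) q (A : {set vec d}) f :
  let P := p * d in
  d' = (P + 2 * q) * d -> p || (0 < q) -> lists n A f ->
  lists n (gadget_vec side P (P + q) d' @: A)
    (fun k => gadget side d P (P + q) (fun t => f (k %/ d' * d + t) != 0) (k %% d')).
Proof.
move=> P ed pq [l [pl lf]].
exists (map_tuple (gadget_vec side P (P + q) d') l); split.
  have inj : injective (@gadget_vec side d P (P + q) d').
    by rewrite ed; apply: gadget_vec_inj.
  apply: uniq_perm; first by rewrite map_inj_uniq // (perm_uniq pl) enum_uniq.
    exact: enum_uniq.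
  move=> v; rewrite mem_enum; apply/mapP/imsetP => -[a aA ->]; exists a => //.
    by rewrite -mem_enum -(perm_mem pl).
  by rewrite (perm_mem pl) mem_enum.
move=> i j; have d'0 : 0 < d' by case: j => j /=; lia.
have d0 : 0 < d by rewrite ed in d'0; lia.
rewrite divnMDl // divn_small // addn0 modnMDl modn_small // tnth_map tnth_mktuple.
have fx t : t < d -> (f (i * d + t) != 0) = nth false (tnth l i) t.
  by move=> lt; have /= -> := lf i (Ordinal lt); rewrite (tnth_nth false); case: (nth _ _ _).
rewrite /gadget /=; case: ifP => lb; last by rewrite !fx // ltn_mod.
by rewrite !fx ?ltn_mod //; move: lb; rewrite /P; case: (p); lia.
Qed.

(** With [X = n + d + 1 >= 2], split [X ^ 8] as [X ^ 5 * X ^ 3]: the first factor is at least 32,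
    the second at least [n * d.+1 ^ 2]. *)
Lemma word_room n d w :
  0 < n -> (n + d).+1 ^ 8 <= 2 ^ w -> 32 * (n * d.+1 ^ 2) <= 2 ^ w.
Proof.
move=> n0; apply: leq_trans; set X := (n + d).+1.
have X2 : 2 <= X by rewrite /X; lia.
rewrite -[8]/(5 + 3) expnD; apply: leq_mul; first by rewrite -[32]/(2 ^ 5) leq_exp2r.
by rewrite expnS leq_mul ?leq_exp2r // /X; lia.
Qed.

Definition gadget_call (N : nat) (c : cmd) (ed eP eQ : exp) : cmd :=
  Seq (load N ed (gadget_exp false N N eP eQ) (gadget_exp true N (N + 1) eP eQ)) c.

(** [brute] gives the answer when [d < 2], straight from the input; otherwise [post] converts the
    oracle's answer. *)
Definition gadget_program (N : nat) (c : cmd) (ed eP eQ post brute : exp) : cmd :=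
  ifexp (N + 10) (Bin OLt (Var 1) (Cst 2)) (asgn (N + 10) 0 brute)
    (Seq (save N)
      (Seq (gadget_call N c ed eP eQ) (asgn (N + 10) 0 post))).

Lemma runs_gadget_call Q c w n d m (p : bool) q N (A B : {set vec d}) f g ed eP eQ T s :
  let P := p * d in
  let d' := (P + 2 * q) * d in
  oracle Q c w n (d ^ 5) T -> cmd_bound c <= N -> 2 < N ->
  0 < n -> 1 < d -> #|A| = n -> #|B| = n -> lists n A f -> lists n B g ->
  32 * (n * d.+1 ^ 2) <= 2 ^ w -> word_state w s -> saved N n d m f g s ->
  p || (0 < q) -> q <= 2 * d -> side_input Q d' [::] ->
  below (N + 10) ed -> below (N + 10) eP -> below (N + 10) eQ ->
  (forall u, saved N n d m f g u ->
    [/\ eval w u ed = d', eval w u eP = P & eval w u eQ = P + q]) ->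
  runs w (gadget_call N c ed eP eQ) s
    (T + (10 * (cost eP + cost eQ) + cost ed + 1000) * (n * d.+1 ^ 2))
    (fun s' => saved N n d m f g s' /\
      correct Q (gadget_vec false P (P + q) d' @: A)
                (gadget_vec true P (P + q) d' @: B) [::] (reg s' 0)).
Proof.
move=> P d' orc lN N2 n0 d1 cA cB lA lB room ws sv pq lq sQ bd bP bQ ev.
have lP : P <= d by rewrite /P; case: (p); lia.
have ld' : d' <= 5 * d ^ 2 by rewrite /d'; nia.
(* Since [d >= 2], [5 <= 2 ^ 3 <= d ^ 3]. *)
have ld5 : d' <= d ^ 5.
  apply: leq_trans ld' _; have -> : d ^ 5 = d ^ 3 * d ^ 2 by rewrite -expnD.
  rewrite leq_mul2r; apply/orP; right.
  by apply: (@leq_trans (2 ^ 3)) => //; rewrite leq_exp2r.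
have room1 : n * d < 2 ^ w by nia.
have room2 : n * d' < 2 ^ w by nia.
have w0 : 0 < w by case: (w) room1 => // ; rewrite expn0; nia.
have inj side : injective (@gadget_vec side d P (P + q) d') by apply: gadget_vec_inj.
pose F side (h : nat -> nat) k :=
  gadget side d P (P + q) (fun t => h (k %/ d' * d + t) != 0) (k %% d') : nat.
apply: (@runs_seq _ _ _ _ _ T _
   (fun s' => saved N n d m f g s' /\ loaded n d' m (F false f) (F true g) s')).
- apply: (@runs_load w N n d m f g d' (F false f) (F true g) _ _ _ s) => //.
  + by rewrite /= bP bQ; lia.
  + by rewrite /= bP bQ; lia.
  + by move=> u /ev[].
  move=> u k lk su ud' uk; have [_ uP uQ] := ev u su; have [u0 u1 u2 uA uB] := su.
  split; apply: (@eval_gadget_exp _ _ _ _ _ w n d d') => //; try lia.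
  + by move=> j; apply: lists_bool lA.
  + by move=> j; apply: lists_bool lB.
- move=> s1 ws1 [sv1 ld1].
  apply: (@runs_oracle _ _ _ _ _ _ _ d m f g _ _ _ [::] s1 orc) => //; rewrite ?card_imset //.
  by apply: (loaded_encodes ld1); [apply: lists_gadget | apply: lists_gadget | left].
- have Z0 : 0 < n * d.+1 ^ 2 by rewrite muln_gt0 n0 expn_gt0.
  have lY : n * d' <= 5 * (n * d.+1 ^ 2) by rewrite mulnCA leq_mul2l; nia.
  move: Z0 lY; rewrite /=; move: (n * d') (n * d.+1 ^ 2) => Y Z Z0 lY.
  set S := _ + _ + 18; have lS := leq_mul (leqnn S) lY.
  have led := leq_pmulr (cost ed) Z0.
  by rewrite /S in lS *; lia.
Qed.

(** In the conclusion, [u] is the state in which the oracle returns. *)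
Lemma runs_gadget_program Q c w n d (p : bool) q N (A B : {set vec d}) e
    ed eP eQ post brute T s :
  let P := p * d in
  let d' := (P + 2 * q) * d in
  oracle Q c w n (d ^ 5) T -> cmd_bound c <= N -> 2 < N ->
  0 < n -> #|A| = n -> #|B| = n ->
  32 * (n * d.+1 ^ 2) <= 2 ^ w -> word_state w s -> encodes n A B e s ->
  p || (0 < q) -> (1 < d -> q <= 2 * d) -> side_input Q d' [::] ->
  below (N + 10) ed -> below (N + 10) eP -> below (N + 10) eQ ->
  below (N + 10) post -> below (N + 10) brute ->
  (forall u f g, saved N n d (reg s 2) f g u ->
    [/\ eval w u ed = d', eval w u eP = P & eval w u eQ = P + q]) ->
  runs w (gadget_program N c ed eP eQ post brute) s
    (d.+1 * T +
     (10 * (cost eP + cost eQ) + cost ed + cost post + cost brute + 1100) *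
       (n * d.+1 ^ 2))
    (fun s' =>
      if d < 2 then reg s' 0 = eval w s brute
      else exists u,
        [/\ reg s' 0 = eval w u post, reg u (N + 1) = d, reg u (N + 2) = reg s 2 &
            correct Q (gadget_vec false P (P + q) d' @: A)
                      (gadget_vec true P (P + q) d' @: B) [::] (reg u 0)]).
Proof.
move=> P d' orc lN N2 n0 cA cB room ws [s0 s1 _ lA lB] pq lq sQ bd bP bQ bpost bb ev.
have room1 : n * d < 2 ^ w by nia.
have room2 : 2 < 2 ^ w by nia.
have w0 : 0 < w by case: (w) room2.
have nd : n * d < n * d.+1 ^ 2 by nia.
have Z0 : 0 < n * d.+1 ^ 2 by lia.
have lT : T <= d.+1 * T by rewrite leq_pmull.
have lpost := leq_pmulr (cost post) Z0.
have lbrute := leq_pmulr (cost brute) Z0.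
pose K := 10 * (cost eP + cost eQ) + cost ed + 1000.
apply: (@runs_le _ _ _ (cost (Bin OLt (Var 1) (Cst 2)) +
  (d.+1 * T + (K + cost post + cost brute + 90) * (n * d.+1 ^ 2)).+1)); first by rewrite /K /=; lia.
apply: runs_ifexp => //=; first by lia.
move=> s' ws' ag; rewrite s1 modn_small // eval_lt //.
case: ltnP => d2 /=.
  apply: (@runs_le _ _ _ (cost brute + 1)); first by lia.
  apply: runs_asgn => //; first by lia.
  move=> s2 [ag2 _]; rewrite ag2 /=; last by lia.
  by rewrite upd_same (eval_agree w ag bb).
have e0 : reg s' 0 = n by rewrite ag.1 //; lia.
have e1 : reg s' 1 = d by rewrite ag.1 //; lia.
have e2 : reg s' 2 = reg s 2 by rewrite ag.1 //; lia.
have svd := @runs_save w N n d s' ws' N2 w0 room1 e0 e1; rewrite e2 in svd.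
apply: (runs_seq (T2 := T + K * (n * d.+1 ^ 2) + (cost post + 1)) svd) => [s3 ws3 sv3|]; last by lia.
have lA3 : lists n A (arr s' 0) by apply: lists_ext lA => j _; apply: ag.2.
have lB3 : lists n B (arr s' 1) by apply: lists_ext lB => j _; apply: ag.2.
have call := @runs_gadget_call Q c w n d (reg s 2) p q N A B _ _ ed eP eQ T s3 orc lN
  N2 n0 d2 cA cB lA3 lB3 room ws3 sv3 pq (lq d2) sQ bd bP bQ (fun u => ev u _ _).
apply: (runs_seq call) (leqnn _) => s4 ws4 [[_ v1 v2 _ _] cor].
apply: runs_asgn => //; first by lia.
move=> s5 [ag5 _]; exists s4; split=> //.
by rewrite ag5 /= ?upd_same //; lia.
Qed.

(** * Inner products in dimension at most one *)

Lemma ip_leq d (a b : vec d) : ip a b <= d.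
Proof.
rewrite /ip -[X in _ <= X]card_ord -sum1_card; apply: leq_sum => i _.
by case: (tnth a i); case: (tnth b i).
Qed.

Lemma lists_single d (A : {set vec d}) f a :
  lists 1 A f -> a \in A -> forall j : 'I_d, f j = tnth a j.
Proof.
move=> [l [pl lf]] aA j.
have := lf ord0 j; rewrite mul0n add0n => ->; congr (nat_of_bool (tnth _ _)).
have : a \in l by rewrite (perm_mem pl) mem_enum.
by move=> /tnthP[i ->]; rewrite (ord1 i).
Qed.

Lemma ip_single n d (A B : {set vec d}) f g a b :
  n * d = 1 -> lists n A f -> lists n B g -> a \in A -> b \in B ->
  ip a b = f 0 * g 0.
Proof.
move=> nd lA lB aA bB; move/eqP: (nd); rewrite muln_eq1 => /andP[/eqP n1 /eqP d1].
subst n d; rewrite /ip big_ord1.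
by have /= <- := lists_single lA aA ord0; have /= <- := lists_single lB bB ord0.
Qed.

(* With [d <= 1], only [n = d = 1] leaves a choice: otherwise [d = 0], or [A]
   and [B] are both the whole of {0,1}. *)
Lemma ip_low_dimension n d (A B : {set vec d}) v :
  0 < n -> #|A| = n -> #|B| = n -> d < 2 -> n * d != 1 -> v <= d ->
  exists a b, [/\ a \in A, b \in B & ip a b = v].
Proof.
move=> n0 cA cB d2 nd lv; case: d A B cA cB d2 nd lv => [|[|//]] A B cA cB _ nd lv.
  have /card_gt0P[a aA] : 0 < #|A| by rewrite cA.
  have /card_gt0P[b bB] : 0 < #|B| by rewrite cB.
  by exists a, b; split=> //; rewrite /ip big_ord0; lia.
have full (S : {set vec 1}) : #|S| = n -> S = setT.
  move=> cS; apply/eqP; rewrite eqEcard subsetT cardsT card_tuple card_bool cS; lia.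
exists [tuple true], [tuple v == 1]; rewrite (full A) // (full B) // !inE; split=> //.
by rewrite /ip big_ord1 !tnth0 mul1n; lia.
Qed.

(** * Reduction of Min-IP to Max-IP *)

Lemma reduces_Min_Max : reduces Min_IP Max_IP.
Proof.
move=> c.
(* [N] also exceeds 2 to stay clear of the input registers 0, 1 and 2. *)
have [N [lN N2]] : exists N, cmd_bound c <= N /\ 2 < N by exists (cmd_bound c).+3; lia.
pose ed := Bin OMul (Cst 2) (Var (N + 1)).
pose post := Bin OSub (Var (N + 1)) (Var 0).
(* If [n = d = 1] the only inner product is that of the two input bits; otherwise [ip_low_dimension]
   provides a pair with inner product 0. *)
pose brute := Cond (Bin OEq (Bin OMul (Var 0) (Var 1)) (Cst 1))
  (Bin OMul (Get 0 (Cst 0)) (Get 1 (Cst 0))) (Cst 0).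
exists (gadget_program N c ed (Cst 0) (Cst 1) post brute).
exists (10 * (cost (Cst 0) + cost (Cst 1)) + cost ed + cost post + cost brute + 1100).
move=> n d A B e w s T n0 cA cB se lw ws en orc.
have room := word_room n0 lw; clear lw.
have room1 : 2 * d < 2 ^ w by nia.
have room2 : n * d < 2 ^ w by nia.
have room3 : 2 < 2 ^ w by nia.
have w0 : 0 < w by case: (w) room3.
apply: runs_sub; last first.
{ apply: (@runs_gadget_program Max_IP c w n d false 1 N A B e) => //; last first.
    move=> u f g [u0 u1 _ _ _]; rewrite /= mod0n u1 !modn_small; try lia.
    by rewrite eval_mul; [split=> //; lia | lia].
  all: by rewrite /=; lia. }
move=> s' _; have [s0 s1 _ lA lB] := en; case: ltnP => d2.
  rewrite /= s0 s1 eval_mul // modn_small; last by lia.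
  rewrite eval_eq // mod0n; case: (eqVneq (n * d) 1) => nd -> /=.
    have nd0 : 0 < n * d by rewrite nd.
    rewrite (lists_bool lA nd0) (lists_bool lB nd0) eval_mul; last first.
      by case: (_ != 0); case: (_ != 0) => //=; lia.
    rewrite -(lists_bool lA nd0) -(lists_bool lB nd0).
    have /card_gt0P[a aA] : 0 < #|A| by rewrite cA.
    have /card_gt0P[b bB] : 0 < #|B| by rewrite cB.
    by split; [exists a, b; split=> // | move=> a' b' aA' bB'];
       rewrite (ip_single nd lA lB).
  by split=> //; apply: (ip_low_dimension n0 cA cB d2).
move=> [u [-> u1 _ [[a' [b' [/imsetP[a aA ->] /imsetP[b bB ->] eip]]] max]]].
have val (x y : vec d) : ip (gadget_vec false (false * d) (false * d + 1) ((false * d + 2 * 1) * d) x)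
    (gadget_vec true (false * d) (false * d + 1) ((false * d + 2 * 1) * d) y) = d - ip x y.
  by rewrite gadget_ip mul0n mul1n.
rewrite val in eip; have lab := ip_leq a b.
rewrite /= u1 -eip eval_sub; last by lia.
rewrite subKn //; split; first by exists a, b.
move=> x y xA yB; have := max _ _ (imset_f _ xA) (imset_f _ yB).
by rewrite val -eip; have := ip_leq x y; lia.
Qed.

(** * Reduction of Exact-IP to Min-IP *)

Lemma reduces_Exact_Min : reduces Exact_IP Min_IP.
Proof.
move=> c.
have [N [lN N2]] : exists N, cmd_bound c <= N /\ 2 < N by exists (cmd_bound c).+3; lia.
pose d_ := Var (N + 1); pose m_ := Var (N + 2).
pose ed := Bin OMul (Bin OAdd d_ (Bin OMul (Cst 4) m_)) d_.
pose eQ := Bin OAdd d_ (Bin OMul (Cst 2) m_).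
(* Tests whether the minimum is [2md - m^2], with [m^2] moved to the left to avoid a subtraction. *)
pose post := Bin OEq (Bin OAdd (Var 0) (Bin OMul m_ m_))
  (Bin OMul (Bin OMul (Cst 2) m_) d_).
(* Outside the case [n = d = 1], every [m <= d] is attained, so the answer is yes. *)
pose brute := Cond (Bin OEq (Bin OMul (Var 0) (Var 1)) (Cst 1))
  (Bin OEq (Bin OMul (Get 0 (Cst 0)) (Get 1 (Cst 0))) (Var 2)) (Cst 1).
exists (gadget_program N c ed d_ eQ post brute).
exists (10 * (cost d_ + cost eQ) + cost ed + cost post + cost brute + 1100).
move=> n d A B [|m [|//]] w s T n0 cA cB //= lm lw ws en orc.
have room := word_room n0 lw; clear lw.
have room1 : 8 * d ^ 2 + 8 * d < 2 ^ w by nia.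
have room2 : n * d < 2 ^ w by nia.
have room3 : 4 < 2 ^ w by nia.
have w0 : 0 < w by case: (w) room3.
have [s0 s1 /(_ 0 isT) /= s2 lA lB] := en.
apply: runs_sub; last first.
{ apply: (@runs_gadget_program Min_IP c w n d true (2 * m) N A B [:: m]) => //; last first.
    move=> u f g [u0 u1 u2 _ _]; rewrite /= u1 u2 s2 !modn_small; try lia.
    rewrite !(@eval_mul _ _ m); try lia.
    rewrite !(@eval_add _ d); try lia.
    rewrite eval_mul; last by nia.
    by split=> //; lia.
  all: by rewrite /=; lia. }
move=> s' _; case: ltnP => d2.
  rewrite /= s0 s1 s2 eval_mul // modn_small; last by lia.
  rewrite eval_eq // mod0n; case: (eqVneq (n * d) 1) => nd -> /=.
    have nd0 : 0 < n * d by rewrite nd.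
    rewrite (lists_bool lA nd0) (lists_bool lB nd0) eval_mul; last first.
      by case: (_ != 0); case: (_ != 0) => //=; lia.
    rewrite -(lists_bool lA nd0) -(lists_bool lB nd0) eval_eq //.
    have /card_gt0P[a aA] : 0 < #|A| by rewrite cA.
    have /card_gt0P[b bB] : 0 < #|B| by rewrite cB.
    congr nat_of_bool; apply/idP/exists_inP => [h|[a' aA' /exists_inP[b' bB' h]]].
      by exists a => //; apply/exists_inP; exists b; rewrite ?(ip_single nd lA lB).
    by rewrite -(ip_single nd lA lB aA' bB').
  have [a [b [aA bB eab]]] := ip_low_dimension n0 cA cB d2 nd lm.
  case: exists_inP => // -[]; exists a => //; apply/exists_inP; exists b => //.
  exact/eqP.
move=> [u [-> u1 u2 [[a' [b' [/imsetP[a aA ->] /imsetP[b bB ->] eip]]] min]]].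
rewrite !gadget_ip mul1n in eip; rewrite s2 in u2.
have lab := ip_leq a b.
(* The difference of the two sides is [(ip x y - m)^2]. *)
have veq (x y : vec d) : ip x y <= d ->
   (ip x y ^ 2 + 2 * m * (d - ip x y) + m * m == 2 * m * d) = (ip x y == m).
  by move=> lxy; apply/eqP/eqP; nia.
rewrite /= u1 u2 -eip modn_small; last by lia.
rewrite (@eval_mul _ m m); last by nia.
rewrite (@eval_mul _ 2 m); last by nia.
rewrite (@eval_mul _ _ d); last by nia.
rewrite eval_add; last by nia.
rewrite eval_eq // veq //; congr nat_of_bool.
apply/idP/exists_inP => [h|[x xA /exists_inP[y yB /eqP h]]].
  by exists a => //; apply/exists_inP; exists b.
have := min _ _ (imset_f _ xA) (imset_f _ yB).
rewrite gadget_ip mul1n -eip h -veq // => lmin.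
have [k dk] : exists k, d = m + k by exists (d - m); lia.
have [j dj] : exists j, d = ip a b + j by exists (d - ip a b); lia.
(* Minimality bounds the value at [(a, b)] by the one at [(x, y)], which is [2md - m^2]; the
   converse bound is [2 m t <= m^2 + t^2] for [t = ip a b]. *)
have [cs _] := nat_Cauchy m (ip a b).
have ek : d - m = k by lia.
have ej : d - ip a b = j by lia.
have e2d : 2 * m * d = 2 * m * m + 2 * m * k by rewrite {1}dk mulnDr.
have e2d' : 2 * m * d = 2 * m * ip a b + 2 * m * j by rewrite {1}dj mulnDr.
apply/eqP; move: lmin; rewrite ek ej => lmin.
by rewrite -!mulnn in lmin cs *; lia.
Qed.

(** * Reduction of Max-IP to Exact-IP by descending search *)

Definition search (N : nat) (c : cmd) : cmd :=
  let r := N + 10 in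
  Seq (save N)
    (* The guess starts at [d + 1] because each round lowers it before asking. *)
    (Seq (asgn r (N + 2) (Bin OAdd (Var (N + 1)) (Cst 1)))
      (Seq (asgn r (N + 4) (Cst 1))
        (Seq
          (While (N + 4)
            (Seq (asgn r (N + 2) (Bin OSub (Var (N + 2)) (Cst 1)))
              (Seq (load N (Var (N + 1)) (Get N (Var (N + 5))) (Get (N + 1) (Var (N + 5))))
                (Seq c (asgn r (N + 4) (Bin OEq (Var 0) (Cst 0)))))))
          (asgn r 0 (Var (N + 2)))))).

Lemma reduces_Max_Exact : reduces Max_IP Exact_IP.
Proof.
move=> c.
have [N [lN N2]] : exists N, cmd_bound c <= N /\ 2 < N by exists (cmd_bound c).+3; lia.
pose r := N + 10.
exists (search N c), 200 => n d A B e w s T n0 cA cB se lw ws en orc.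
have room := word_room n0 lw; clear lw.
have room1 : n * d < 2 ^ w by nia.
have room2 : d.+1 < 2 ^ w by nia.
have room3 : 2 < 2 ^ w by nia.
have w0 : 0 < w by case: (w) room3.
have w1 := word_gt1 w0.
have ld5 : d <= d ^ 5 by case: (d) => // k; rewrite -{1}[k.+1]expn1 leq_pexp2l.
have [s0 s1 _ lA lB] := en.
pose f := arr s 0; pose g := arr s 1.
pose body := Seq (asgn r (N + 2) (Bin OSub (Var (N + 2)) (Cst 1)))
  (Seq (load N (Var (N + 1)) (Get N (Var (N + 5))) (Get (N + 1) (Var (N + 5))))
    (Seq c (asgn r (N + 4) (Bin OEq (Var 0) (Cst 0))))).
(* A bound for one round; at most [d + 1] rounds are run. *)
pose K := T + 22 * (n * d) + 40.
have step m u : word_state w u -> saved N n d m.+1 f g u -> m <= d ->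
    runs w body u K (fun u' => saved N n d m f g u' /\
      reg u' (N + 4) = ~~ [exists a in A, exists b in B, ip a b == m]).
  move=> wu su lm; have [u0 u1 u2 uA uB] := su.
  apply: (@runs_le _ _ _ (3 + 1 + (22 * (n * d) + 25 + (T + 4)))); first by rewrite /K; lia.
  apply: (@runs_asgn_seq _ _ _ _ m _ _ _ _ _ wu (agree_refl _ _)) => /=; try lia.
    by rewrite u2 modn_small // eval_sub; lia.
  move=> v wv ag.
  have sv : saved N n d m f g v.
    by apply: (saved_agree (leqnn _) ag); split; lookup.
  apply: (runs_seq (@runs_load w N n d m f g d f g _ _ _ v wv _ w0 room1 _ _ _ sv _ _)) => /=;
    try lia; first by move=> x [].
    by move=> x q lq [_ _ _ xA xB] _ -> /=; rewrite xA ?xB.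
  move=> v1 wv1 [sv1 ld1].
  have en1 : encodes n A B [:: m] v1 by apply: (loaded_encodes ld1) => //; right.
  have call := @runs_oracle Exact_IP c w n _ T N d m f g d A B [:: m] v1 orc lN sv1
    ld5 cA cB lm wv1 en1.
  apply: (runs_seq call) (leqnn _).
  move=> v2 wv2 [sv2 cor].
  apply: runs_asgn => //=; try lia.
  move=> v3 ag3; split.
    by apply: (saved_agree _ ag3) => //; apply: saved_set_reg; rewrite //; lia.
  by rewrite ag3.1 /=; [rewrite upd_same mod0n eval_eq // cor; case: [exists _ in _, _] | lia].
  by rewrite /=; lia.
(* The invariant is that no inner product exceeds the next guess [m], so the first guess that is
   attained is the maximum. *)
have loop m u : word_state w u -> saved N n d m.+1 f g u -> reg u (N + 4) != 0 ->
    m <= d -> (forall a b, a \in A -> b \in B -> ip a b <= m) ->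
    runs w (While (N + 4) body) u (m.+1 * K.+1 + 1)
      (fun s' => correct Max_IP A B e (reg s' (N + 2))).
  elim: m u => [|m IH] u wu su flag lm le;
    have [t1 [u1 [x1 l1 wu1 [su1 f1]]]] := step _ _ wu su lm.
    (* At guess 0 the invariant forces all inner products to vanish, and the sets are nonempty: the
       search stops before the guess can drop below 0. *)
    have found : [exists a in A, exists b in B, ip a b == 0].
      have /card_gt0P[a aA] : 0 < #|A| by rewrite cA.
      have /card_gt0P[b bB] : 0 < #|B| by rewrite cB.
      apply/exists_inP; exists a => //; apply/exists_inP; exists b => //.
      by rewrite -leqn0 le.
    rewrite found in f1; exists (t1 + 1).+1, u1; split=> //; last 1 first.
    + have [_ _ -> _ _] := su1; split=> //.
      by have /exists_inP[a aA /exists_inP[b bB /eqP h]] := found; exists a, b.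
    + by apply: exec_While_true x1 _ => //; apply: exec_While_false.
    + by lia.
  case found : [exists a in A, exists b in B, ip a b == m.+1] in f1.
    exists (t1 + 1).+1, u1; split=> //; last 1 first.
    + have [_ _ -> _ _] := su1; split=> //.
      by have /exists_inP[a aA /exists_inP[b bB /eqP h]] := found; exists a, b.
    + by apply: exec_While_true x1 _ => //; apply: exec_While_false.
    + by lia.
  have [| | |t2 [u2 [x2 l2 wu2 q2]]] := IH u1 wu1 su1.
  + by rewrite f1.
  + by lia.
  + move=> a b aA bB; have := le a b aA bB; rewrite leq_eqVlt => /orP[eab|//].
    by move/negbT/negP: found; case; apply/exists_inP; exists a => //; apply/exists_inP; exists b.
  exists (t1 + t2).+1, u2; split=> //; first by apply: exec_While_true x2.
  by lia.
have Z0 : 0 < n * d.+1 ^ 2 by rewrite muln_gt0 n0 expn_gt0.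
have lZ1 : n * d * d.+1 <= n * d.+1 ^ 2 by nia.
have lZ2 : d.+1 <= n * d.+1 ^ 2 by nia.
have lZ3 : n * d <= n * d.+1 ^ 2 by nia.
apply: (@runs_le _ _ _ (22 * (n * d) + 23 + (3 + 1 + (1 + 1 + (d.+1 * K.+1 + 1 + 2))))).
  by rewrite /K; lia.
apply: (runs_seq (@runs_save w N n d s ws _ w0 room1 s0 s1) _ (leqnn _)) => // u wu su.
have [u0 u1 _ _ _] := su.
apply: (@runs_asgn_seq _ _ _ _ d.+1 _ _ _ _ _ wu (agree_refl _ _)) => /=; try lia.
  by rewrite u1 modn_small // eval_add; lia.
move=> v wv ag.
apply: (@runs_asgn_seq _ _ _ _ 1 _ _ _ _ _ wv ag) => /=; try lia.
  by rewrite modn_small.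
move=> v1 wv1 ag1.
have sv1 : saved N n d d.+1 f g v1.
  by apply: (saved_agree (leqnn _) ag1); have [_ _ _ uA uB] := su; split; lookup.
have flag : reg v1 (N + 4) != 0 by rewrite ag1.1; [lookup | lia].
have all_leq a b : a \in A -> b \in B -> ip a b <= d by move=> _ _; apply: ip_leq.
apply: (runs_seq (loop d v1 wv1 sv1 flag (leqnn _) all_leq) _ (leqnn _)) => v2 wv2 cor.
apply: runs_asgn => //=; try lia.
by move=> v3 [ag3 _]; rewrite ag3 /= ?upd_same //; lia.
Qed.

(** * Reductions preserve truly subquadratic time *)

Lemma INR_muln m n : INR (m * n) = (INR m * INR n)%coqR.
Proof. exact: mult_INR. Qed.

Lemma INR_addn m n : INR (m + n) = (INR m + INR n)%coqR.
Proof. exact: plus_INR. Qed.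

Lemma INR_expn m k : INR (m ^ k) = (INR m ^ k)%coqR.
Proof. by elim: k => [|k IH] //; rewrite expnS INR_muln IH. Qed.

Lemma INR_leq m n : m <= n -> (INR m <= INR n)%coqR.
Proof. by move=> lmn; apply: le_INR; lia. Qed.

(** Passes from the real time bound of [solvable] to the natural one of [oracle]. *)
Lemma nat_floor (r : R) :
  (0 <= r)%coqR ->
  exists T : nat, (INR T <= r)%coqR /\ forall t : nat, (INR t <= r)%coqR -> t <= T.
Proof.
move=> r0; have [a1 a2] := archimed r.
have u0 : (0 < up r)%Z by apply: lt_IZR; lra.
exists (Z.to_nat (up r - 1)); split.
  by rewrite INR_IZR_INZ Z2Nat.id ?minus_IZR; [lra | lia].
move=> t lt; suff : (Z.of_nat t < up r)%Z by lia.
by apply: lt_IZR; rewrite -INR_IZR_INZ; lra.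
Qed.

Lemma reduces_subquadratic P Q :
  reduces P Q -> truly_subquadratic Q -> truly_subquadratic P.
Proof.
move=> red [eps [delta [eps0 delta0 [c [k [C sol]]]]]].
have [c' [K red_c]] := red c.
(* With [N = INR n], the calls cost [O(N^(delta' + 2 - eps))] and the overhead is
   [O(N^(1 + 2 delta'))]. As [delta' <= eps / 2] and [delta' <= 1 / 4], these exponents are at most
   [2 - eps / 2] and [3 / 2], hence at most [2 - eps']. *)
pose eps' := Rmin (eps / 2) (1 / 2).
pose delta' := Rmin (delta / 5) (Rmin (eps / 2) (1 / 4)).
have e1 : (eps' <= eps / 2)%coqR by apply: Rmin_l.
have e2 : (eps' <= 1 / 2)%coqR by apply: Rmin_r.
have d1 : (delta' <= delta / 5)%coqR by apply: Rmin_l.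
have d23 : (delta' <= Rmin (eps / 2) (1 / 4))%coqR by apply: Rmin_r.
have d2 : (delta' <= eps / 2)%coqR by apply: Rle_trans d23 (Rmin_l _ _).
have d3 : (delta' <= 1 / 4)%coqR by apply: Rle_trans d23 (Rmin_r _ _).
have delta'0 : (0 < delta')%coqR by do 2 (apply: Rmin_pos; first lra); lra.
exists eps', delta'; split=> //; first by apply: Rmin_pos; lra.
(* The 8 is what [reduces] asks for; [5 * k] serves the oracle, as [n + d' + 1 <= (n + d + 1)^5] for
   [d' <= d^5]. The factors 2 and 4 come from [d + 1 <= 2x] and its square. *)
exists c', (5 * k + 8), (2 * Rabs C + 4 * INR K)%coqR.
move=> n d A B e w s n0 ld cA cB se lw ws en.
pose N := INR n; have N1 : (1 <= N)%coqR by apply: (@INR_leq 1 n).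
pose x := Rpower N delta'.
have mono a b : (a <= b)%coqR -> (Rpower N a <= Rpower N b)%coqR.
  by move=> lab; apply: Rle_Rpower.
have x1 : (1 <= x)%coqR.
  by rewrite -(Rpower_O N); [apply: mono; lra | lra].
have d0 := pos_INR d.
(* The absolute value makes the budget nonnegative, as [nat_floor] requires. *)
pose Tr := (Rabs C * Rpower N (2 - eps))%coqR.
have pow0 a : (0 < Rpower N a)%coqR by apply: exp_pos.
have C0 := Rabs_pos C.
have Tr0 : (0 <= Tr)%coqR by apply: Rmult_le_pos => //; apply: Rlt_le.
have [T [lT maxT]] := nat_floor Tr0.
have lw8 : (n + d).+1 ^ 8 <= 2 ^ w.
  by apply: leq_trans lw; rewrite leq_pexp2l //; lia.
have orc : oracle Q c w n (d ^ 5) T.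
  move=> d' A' B' e' s' ld' cA' cB' se' ws' en'.
  have lD : (INR d' <= Rpower N delta)%coqR.
    apply: Rle_trans (INR_leq ld') _; rewrite INR_expn.
    apply: (@Rle_trans _ (x ^ 5)%coqR); first by apply: pow_incr.
    rewrite -Rpower_pow; last by rewrite /x; apply: pow0.
    by rewrite Rpower_mult; apply: mono; rewrite /=; lra.
  have lw' : (n + d').+1 ^ k <= 2 ^ w.
    apply: leq_trans lw; apply: (@leq_trans ((n + d).+1 ^ (5 * k))); last first.
      by rewrite leq_pexp2l //; lia.
    rewrite expnM; case: (posnP k) => [->|k0]; first by rewrite !expn0.
    rewrite leq_exp2r //.
    apply: (@leq_trans ((n.+1 + d) * (n + d).+1 ^ 4)); last by rewrite expnS addSn.
    rewrite mulnDl -addSn; apply: leq_add; first by rewrite leq_pmulr // expn_gt0.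
    by apply: leq_trans ld' _; rewrite expnS leq_mul2l leq_exp2r //; lia.
  have [t [s1 [x_t cor lt]]] := sol n d' A' B' e' w s' n0 lD cA' cB' se' lw' ws' en'.
  exists t, s1; split=> //; last exact: exec_word x_t ws'.
  apply: maxT; apply: Rle_trans lt _; apply: Rmult_le_compat_r; first exact: Rlt_le.
  exact: Rle_abs.
have [t [s' [x_t lt _ cor]]] := red_c n d A B e w s T n0 cA cB se lw8 ws en orc.
exists t, s'; split=> //.
apply: Rle_trans (INR_leq lt) _.
rewrite INR_addn (INR_muln d.+1) (INR_muln K) (INR_muln n) INR_expn S_INR -/N.
have ld2 : (INR d + 1 <= 2 * x)%coqR by rewrite -/N -/x in ld; lra.
rewrite [X in (_ <= X)%coqR]Rmult_plus_distr_r; apply: Rplus_le_compat.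
  apply: (@Rle_trans _ (2 * x * Tr)%coqR).
    by apply: Rmult_le_compat => //; [lra | apply: pos_INR].
  have -> : (2 * x * Tr = 2 * Rabs C * (x * Rpower N (2 - eps)))%coqR by rewrite /Tr; ring.
  apply: Rmult_le_compat_l; first by lra.
  by rewrite /x -Rpower_plus; apply: mono; lra.
have K0 := pos_INR K.
apply: (@Rle_trans _ (INR K * (N * (2 * x) ^ 2))%coqR).
  apply: Rmult_le_compat_l => //; apply: Rmult_le_compat_l; first by lra.
  by apply: pow_incr; lra.
have -> : (INR K * (N * (2 * x) ^ 2) = 4 * INR K * (N * (x * x)))%coqR by ring.
apply: Rmult_le_compat_l; first by lra.
rewrite -{1}(Rpower_1 N); last by lra.
by rewrite /x -!Rpower_plus; apply: mono; lra.
Qed.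

(** * Equivalence of the three problems by the cycle of reductions *)

Theorem theorem1p6 :
  (truly_subquadratic Max_IP /\ truly_subquadratic Min_IP /\
   truly_subquadratic Exact_IP) \/
  (~ truly_subquadratic Max_IP /\ ~ truly_subquadratic Min_IP /\
   ~ truly_subquadratic Exact_IP).
Proof.
have max_min := reduces_subquadratic reduces_Min_Max.
have min_exact := reduces_subquadratic reduces_Exact_Min.
have exact_max := reduces_subquadratic reduces_Max_Exact.
by case: (classic (truly_subquadratic Max_IP)); [left | right]; tauto.
Qed.
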